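(* Let $(A,\Delta)$ be a left multiplier Hopf algebra with counit $\varepsilon$, and let $S,S':A\to L(A)$ be the maps defined by $S(a)b=(\varepsilon\otimes\iota)T_1^{-1}(a\otimes b)$ and $S'(a)c=(\iota\otimes\varepsilon)T_4^{-1}(c\otimes a)$. (i) For all $a,b\in A$ we have $((\iota\otimes S)\Delta(a))(1\otimes b)\in A\otimes A$ and $$m\big(((\iota\otimes S)\Delta(a))(1\otimes b)\big)=\varepsilon(a)b.$$ (ii) For all $a,c\in A$ we have $((S'\otimes\iota)\Delta(a))(c\otimes 1)\in A\otimes A$ and $$m^{\mathrm{op}}\big(((S'\otimes\iota)\Delta(a))(c\otimes 1)\big)=\varepsilon(a)c.$$
   Context: Algebras are associative algebras over $\mathbb C$, not necessarily unital, and $A$ is non-degenerate: if $ab=0$ for all $b\in A$ then $a=0$, and if $ab=0$ for all $a\in A$ then $b=0$. $M(A\otimes A)$ denotes the multiplier algebra of $A\otimes A$, $\iota$ the identity map, $m:A\otimes A\to A$ the multiplication and $m^{\mathrm{op}}(p\otimes q)=qp$. $L(A)$ is the algebra of left multipliers of $A$, i.e. linear maps $x:A\to A$, $a\mapsto xa$, with $x(ab)=(xa)b$. A left multiplier Hopf algebra is a pair $(A,\Delta)$ where $A$ is a non-degenerate algebra and $\Delta:A\to M(A\otimes A)$ is a homomorphism such that: the maps $T_1(a\otimes b)=\Delta(a)(1\otimes b)$ and $T_4(c\otimes a)=\Delta(a)(c\otimes 1)$ have range in $A\otimes A$; $\Delta$ is coassociative, i.e. $((\Delta\otimes\iota)(\Delta(a)(1\otimes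 b)))(c\otimes 1\otimes 1)=((\iota\otimes\Delta)(\Delta(a)(c\otimes 1)))(1\otimes 1\otimes b)$ for all $a,b,c\in A$; and $T_1$, $T_4$ are bijections from $A\otimes A$ to itself. The counit $\varepsilon:A\to\mathbb C$ is the linear map determined by $\varepsilon(a)b=m(T_1^{-1}(a\otimes b))$ for all $a,b\in A$; it satisfies $(\iota\otimes\varepsilon)(\Delta(a)(c\otimes 1))=ac$ and $(\varepsilon\otimes\iota)(\Delta(a)(1\otimes b))=ab$. Meaning of the expressions in the claim: for $\sum_i p_i\otimes q_i\in A\otimes A$ put $(\iota\otimes S)(\sum_i p_i\otimes q_i)(1\otimes b)=\sum_i p_i\otimes S(q_i)b$ and $(S'\otimes\iota)(\sum_i p_i\otimes q_i)(c\otimes 1)=\sum_i S'(p_i)c\otimes q_i$. Then $((\iota\otimes S)\Delta(a))(1\otimes b)\in A\otimes A$ means that there is a (necessarily unique) element $x\in A\otimes A$ with $x(c\otimes 1)=(\iota\otimes S)(\Delta(a)(c\otimes 1))(1\otimes b)$ for all $c\in A$, and $((\iota\otimes S)\Delta(a))(1\otimes b)$ denotes this $x$. Likewise $((S'\otimes\iota)\Delta(a))(c\otimes 1)\in A\otimes A$ means that there is a (necessarily unique) $y\in A\otimes A$ with $y(1\otimes b)=(S'\otimes\iota)(\Delta(a)(1\otimes b))(c\otimes 1)$ for all $b\in A$, and the expression denotes this $y$. *)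

(* Defs.v *)
From HB Require Import structures.
From mathcomp Require Export all_boot all_order all_algebra.
From mathcomp Require Export generic_quotient.
From mathcomp Require Export boolp classical_sets reals.
From mathcomp Require Export complex.

Set Implicit Arguments.
Unset Strict Implicit.
Unset Printing Implicit Defensive.

Export GRing.Theory.
Global Open Scope ring_scope.

Reserved Notation "a ∙ b" (at level 40, left associativity).
Reserved Notation "a ⊗ b" (at level 39, left associativity).
Reserved Notation "x ⊠ y" (at level 39, left associativity).

(** * Algebras, not necessarily unital *)

HB.mixin Record Lmodule_isNuAlgebra (K : fieldType) A of GRing.Lmodule K A := {
  nmul : A -> A -> A;
  nmulA : associative nmul;
  nmul_linearl : forall b, linear (nmul^~ b);
  nmul_linearr : forall a, linear (nmul a)
}.

#[short(type="nuAlgType")]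
HB.structure Definition NuAlgebra (K : fieldType) :=
  {A of GRing.Lmodule K A & Lmodule_isNuAlgebra K A}.

Notation "a ∙ b" := (nmul a b) : ring_scope.

Definition nondegenerate (K : fieldType) (A : nuAlgType K) : Prop :=
  (forall a : A, (forall b, a ∙ b = 0) -> a = 0) /\
  (forall b : A, (forall a, a ∙ b = 0) -> b = 0).

(** * Algebraic tensor products

   A finite formal sum of symbols [u ⊗ v] is a list of pairs; [U ⊗ V] is the
   set of lists modulo the congruence generated by the usual relations.  The
   commutative monoid presented in this way is already a vector space, with
   [- (u ⊗ v) = (- u) ⊗ v] and [k *: (u ⊗ v) = (k *: u) ⊗ v].  *)

Section Tensor.
Variables (K : fieldType) (U V : lmodType K).

Inductive tensor_rel : seq (U * V) -> seq (U * V) -> Prop :=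
| tensor_refl s : tensor_rel s s
| tensor_sym s t : tensor_rel s t -> tensor_rel t s
| tensor_trans s t r : tensor_rel s t -> tensor_rel t r -> tensor_rel s r
| tensor_cat s s' t t' :
    tensor_rel s s' -> tensor_rel t t' -> tensor_rel (s ++ t) (s' ++ t')
| tensor_catC s t : tensor_rel (s ++ t) (t ++ s)
| tensor_zero v : tensor_rel [:: (0, v)] [::]
| tensor_addl u u' v : tensor_rel [:: (u + u', v)] [:: (u, v); (u', v)]
| tensor_addr u v v' : tensor_rel [:: (u, v + v')] [:: (u, v); (u, v')]
| tensor_scale k u v : tensor_rel [:: (k *: u, v)] [:: (u, k *: v)].

Definition tensor_relb (s t : seq (U * V)) : bool := `[< tensor_rel s t >].

Lemma tensor_relb_refl : reflexive tensor_relb.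
Proof. by move=> s; apply/asboolP; apply: tensor_refl. Qed.

Lemma tensor_relb_sym : symmetric tensor_relb.
Proof. by move=> s t; apply/asboolP/asboolP; apply: tensor_sym. Qed.

Lemma tensor_relb_trans : transitive tensor_relb.
Proof.
by move=> t s r /asboolP st /asboolP tr; apply/asboolP; apply: tensor_trans tr.
Qed.

Canonical tensor_equiv :=
  EquivRel tensor_relb tensor_relb_refl tensor_relb_sym tensor_relb_trans.

Definition tensor : Type := {eq_quot tensor_relb}%qT.

HB.instance Definition _ := Choice.on tensor.
HB.instance Definition _ := EqQuotient.on tensor.

Definition tclass (s : seq (U * V)) : tensor := (\pi_tensor s)%qT.
Definition tpure (u : U) (v : V) : tensor := tclass [:: (u, v)].

Lemma tclassP s t : tensor_rel s t <-> tclass s = tclass t.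
Proof.
split=> [st|/eqP]; last by rewrite eqmodE => /asboolP.
by apply/eqP; rewrite eqmodE; apply/asboolP.
Qed.

Lemma tclassK (x : tensor) : tclass (repr x) = x.
Proof. exact: reprK. Qed.

Definition tscale_seq k (s : seq (U * V)) := [seq (k *: p.1, p.2) | p <- s].

Lemma tscale_seq_rel k s t :
  tensor_rel s t -> tensor_rel (tscale_seq k s) (tscale_seq k t).
Proof.
elim=> {s t} [s|s t _|s t r _ st _ tr|s s' t t' _ ss _ tt|s t|v|u u' v|u v v'|c u v].
- exact: tensor_refl.
- exact: tensor_sym.
- exact: tensor_trans tr.
- by rewrite /tscale_seq !map_cat; apply: tensor_cat.
- by rewrite /tscale_seq !map_cat; apply: tensor_catC.
- by rewrite /= scaler0; apply: tensor_zero.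
- by rewrite /= scalerDr; apply: tensor_addl.
- exact: tensor_addr.
- by rewrite /= scalerA mulrC -scalerA; apply: tensor_scale.
Qed.

Definition tadd (x y : tensor) : tensor := tclass (repr x ++ repr y).
Definition tscale k (x : tensor) : tensor := tclass (tscale_seq k (repr x)).

Lemma tclass_repr s : tensor_rel (repr (tclass s)) s.
Proof. by apply/tclassP; rewrite tclassK. Qed.

Lemma taddE s t : tadd (tclass s) (tclass t) = tclass (s ++ t).
Proof. by apply/tclassP; apply: tensor_cat; apply: tclass_repr. Qed.

Lemma tscaleE k s : tscale k (tclass s) = tclass (tscale_seq k s).
Proof. by apply/tclassP/tscale_seq_rel/tclass_repr. Qed.

Lemma tclass_ind (P : tensor -> Prop) :
  (forall s, P (tclass s)) -> forall x, P x.
Proof. by move=> Ps x; rewrite -(tclassK x). Qed.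

Lemma taddA : associative tadd.
Proof.
elim/tclass_ind=> s; elim/tclass_ind=> t; elim/tclass_ind=> r.
by rewrite !taddE catA.
Qed.

Lemma taddC : commutative tadd.
Proof.
elim/tclass_ind=> s; elim/tclass_ind=> t; rewrite !taddE.
by apply/tclassP/tensor_catC.
Qed.

Lemma tadd0 : left_id (tclass [::]) tadd.
Proof. by elim/tclass_ind=> s; rewrite taddE. Qed.

Lemma tscale_addl_rel k l s :
  tensor_rel (tscale_seq (k + l) s) (tscale_seq k s ++ tscale_seq l s).
Proof.
elim: s => [|[u v] s IHs]; first exact: tensor_refl.
apply: (@tensor_trans _ ([:: (k *: u, v); (l *: u, v)] ++
                         (tscale_seq k s ++ tscale_seq l s))).
  rewrite -[tscale_seq _ (_ :: _)]/([:: ((k + l) *: u, v)] ++ tscale_seq (k + l) s).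
  by apply: tensor_cat IHs; rewrite scalerDl; apply: tensor_addl.
rewrite -[X in tensor_rel X _]/([:: (k *: u, v)] ++
  ([:: (l *: u, v)] ++ (tscale_seq k s ++ tscale_seq l s))).
rewrite -[X in tensor_rel _ X]/([:: (k *: u, v)] ++
  (tscale_seq k s ++ ([:: (l *: u, v)] ++ tscale_seq l s))).
apply: tensor_cat; first exact: tensor_refl.
rewrite !catA; apply: tensor_cat; last exact: tensor_refl.
exact: tensor_catC.
Qed.

Lemma tscale0_rel s : tensor_rel (tscale_seq 0 s) [::].
Proof.
elim: s => [|[u v] s IHs]; first exact: tensor_refl.
rewrite -[tscale_seq _ _]/([:: (0 *: u, v)] ++ tscale_seq 0 s) -[[::]]/([::] ++ [::]).
by apply: tensor_cat IHs; rewrite scale0r; apply: tensor_zero.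
Qed.

Lemma tscale1_seq s : tscale_seq 1 s = s.
Proof. by elim: s => //= -[u v] s ->; rewrite scale1r. Qed.

Lemma taddN : left_inverse (tclass [::]) (tscale (- 1)) tadd.
Proof.
elim/tclass_ind=> s; rewrite tscaleE -{2}(tscale1_seq s) taddE.
apply/tclassP; apply: tensor_trans (tscale0_rel s); apply: tensor_sym.
by rewrite -{1}(addNr 1); apply: tscale_addl_rel.
Qed.

HB.instance Definition _ := GRing.isZmodule.Build tensor taddA taddC tadd0 taddN.

Lemma tclassD s t : tclass (s ++ t) = tclass s + tclass t.
Proof. by rewrite -taddE. Qed.

Lemma tscaleA k l x : tscale k (tscale l x) = tscale (k * l) x.
Proof.
elim/tclass_ind: x => s; rewrite !tscaleE; congr tclass.
by rewrite /tscale_seq -map_comp; apply: eq_map => p /=; rewrite scalerA.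
Qed.

Lemma tscale1 : left_id 1 tscale.
Proof. by elim/tclass_ind=> s; rewrite tscaleE tscale1_seq. Qed.

Lemma tscaleDr : right_distributive tscale +%R.
Proof.
move=> k; elim/tclass_ind=> s; elim/tclass_ind=> t.
by rewrite -tclassD !tscaleE -tclassD /tscale_seq map_cat.
Qed.

Lemma tscaleDl x : {morph tscale^~ x : k l / k + l}.
Proof.
move=> k l; elim/tclass_ind: x => s; rewrite !tscaleE -tclassD.
by apply/tclassP/tscale_addl_rel.
Qed.

HB.instance Definition _ :=
  GRing.Zmodule_isLmodule.Build K tensor tscaleA tscale1 tscaleDr tscaleDl.

Lemma tpureDl u u' v : tpure (u + u') v = tpure u v + tpure u' v.
Proof. by rewrite -tclassD; apply/tclassP/tensor_addl. Qed.

Lemma tpureDr u v v' : tpure u (v + v') = tpure u v + tpure u v'.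
Proof. by rewrite -tclassD; apply/tclassP/tensor_addr. Qed.

Lemma tpureZl k u v : tpure (k *: u) v = k *: tpure u v.
Proof. by rewrite -[RHS]/(tscale _ _) tscaleE. Qed.

Lemma tpureZr k u v : tpure u (k *: v) = k *: tpure u v.
Proof. by rewrite -tpureZl; apply/tclassP/tensor_sym/tensor_scale. Qed.

Lemma tclassE s : tclass s = \sum_(p <- s) tpure p.1 p.2.
Proof.
elim: s => [|[u v] s IHs]; first by rewrite big_nil.
by rewrite big_cons -IHs -tclassD.
Qed.

Lemma tensor_ind (P : tensor -> Prop) :
  P 0 -> (forall u v x, P x -> P (tpure u v + x)) -> forall x, P x.
Proof.
move=> P0 PD; elim/tclass_ind=> s; rewrite tclassE.
by elim: s => [|p s IHs]; rewrite ?big_nil // big_cons; apply: PD.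
Qed.

End Tensor.

Arguments tpure {K U V}.
Notation "U ⊗ V" := (tensor U%type V%type) : type_scope.
Notation "u ⊗ v" := (tpure u v) : ring_scope.

(** The linear map [U ⊗ V -> W] induced by a bilinear [f].  It is defined for
    every [f], but is meaningful ([tliftE], [tlift_linear]) for bilinear ones
    only; the maps to which it is applied below are bilinear, for [T1], [T4],
    [id_S] and [S'_id] by the axioms of a left multiplier Hopf algebra. *)

Definition bilin (K : fieldType) (U V W : lmodType K) (f : U -> V -> W) : Prop :=
  (forall v, linear (f^~ v)) /\ (forall u, linear (f u)).

Section Lift.
Variables (K : fieldType) (U V W : lmodType K) (f : U -> V -> W).

Definition tlift (x : U ⊗ V) : W := \sum_(p <- repr x) f p.1 p.2.

Hypothesis f_bilin : bilin f.

Let fDl u u' v : f (u + u') v = f u v + f u' v.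
Proof. by have := f_bilin.1 v 1 u u'; rewrite !scale1r. Qed.
Let fDr u v v' : f u (v + v') = f u v + f u v'.
Proof. by have := f_bilin.2 u 1 v v'; rewrite !scale1r. Qed.
Let f0l v : f 0 v = 0.
Proof. by apply: (addrI (f 0 v)); rewrite -fDl !addr0. Qed.
Let f0r u : f u 0 = 0.
Proof. by apply: (addrI (f u 0)); rewrite -fDr !addr0. Qed.
Let fZl k u v : f (k *: u) v = k *: f u v.
Proof. by have := f_bilin.1 v k u 0; rewrite /= !addr0 f0l addr0. Qed.
Let fZr k u v : f u (k *: v) = k *: f u v.
Proof. by have := f_bilin.2 u k v 0; rewrite /= !addr0 f0r addr0. Qed.

Lemma tlift_rel s t : tensor_rel s t ->
  \sum_(p <- s) f p.1 p.2 = \sum_(p <- t) f p.1 p.2.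
Proof.
elim=> {s t} [//|s t _ ->|s t r _ -> _ ->|s s' t t' _ ss _ tt|s t|v|u u' v|u v v'|c u v] //;
  rewrite ?big_cat /= ?big_cons ?big_nil ?addr0 /=.
- by rewrite ss tt.
- by rewrite addrC.
- exact: f0l.
- exact: fDl.
- exact: fDr.
- by rewrite fZl fZr.
Qed.

Lemma tlift_class s : tlift (tclass s) = \sum_(p <- s) f p.1 p.2.
Proof. exact/tlift_rel/tclass_repr. Qed.

Lemma tliftE u v : tlift (u ⊗ v) = f u v.
Proof. by rewrite tlift_class big_seq1. Qed.

Lemma tlift_linear : linear tlift.
Proof.
move=> k; elim/tclass_ind=> s; elim/tclass_ind=> t.
rewrite -[k *: _]/(tscale k _) tscaleE -tclassD !tlift_class big_cat /=.
rewrite big_map scaler_sumr; congr (_ + _).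
by apply: eq_bigr => p _ /=; rewrite fZl.
Qed.

End Lift.

Section LinearFacts.
Variable (K : fieldType).
Implicit Types (U V W : lmodType K).

Lemma linearD_ U V (f : U -> V) : linear f -> forall x y, f (x + y) = f x + f y.
Proof. by move=> lf x y; have := lf 1 x y; rewrite !scale1r. Qed.

Lemma linear0_ U V (f : U -> V) : linear f -> f 0 = 0.
Proof. by move=> lf; apply: (addrI (f 0)); rewrite -(linearD_ lf) !addr0. Qed.

Lemma linearZ_ U V (f : U -> V) : linear f -> forall k x, f (k *: x) = k *: f x.
Proof. by move=> lf k x; have := lf k x 0; rewrite (linear0_ lf) !addr0. Qed.

Lemma linear_comp U V W (g : V -> W) (f : U -> V) :
  linear g -> linear f -> linear (g \o f).
Proof. by move=> lg lf k x y /=; rewrite lf lg. Qed.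

Lemma linear_add U V (f g : U -> V) :
  linear f -> linear g -> linear (fun x => f x + g x).
Proof. by move=> lf lg k x y; rewrite lf lg scalerDr addrACA. Qed.

Lemma linear_scale U V c (f : U -> V) : linear f -> linear (fun x => c *: f x).
Proof. by move=> lf k x y; rewrite lf scalerDr !scalerA mulrC. Qed.

Lemma linear_zero U V : linear (fun _ : U => 0 : V).
Proof. by move=> k x y; rewrite scaler0 addr0. Qed.

Lemma tpure_bilin U V : bilin (@tpure K U V).
Proof.
by split=> [v|u] k x y; rewrite ?tpureDl ?tpureZl ?tpureDr ?tpureZr.
Qed.

Lemma bilin_comp U V U' V' W (h : U' -> V' -> W) (f : U -> U') (g : V -> V') :
  bilin h -> linear f -> linear g -> bilin (fun u v => h (f u) (g v)).
Proof. by move=> [h1 h2] lf lg; split=> [v|u] k x y; rewrite ?lf ?lg ?h1 ?h2. Qed.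

Lemma eq_tensor U V W (f g : U ⊗ V -> W) : linear f -> linear g ->
  (forall u v, f (u ⊗ v) = g (u ⊗ v)) -> forall x, f x = g x.
Proof.
move=> lf lg fg; elim/tensor_ind=> [|u v x IHx]; first by rewrite (linear0_ lf) (linear0_ lg).
by rewrite (linearD_ lf) (linearD_ lg) fg IHx.
Qed.

(** [tmap f g] is the tensor product [f ⊗ g] of two linear maps. *)
Definition tmap U V U' V' (f : U -> U') (g : V -> V') : U ⊗ V -> U' ⊗ V' :=
  tlift (fun u v => f u ⊗ g v).

Section Tmap.
Variables (U V U' V' : lmodType K) (f : U -> U') (g : V -> V').
Hypotheses (lf : linear f) (lg : linear g).

Lemma tmap_bilin : bilin (fun u v => f u ⊗ g v).
Proof. exact: bilin_comp (@tpure_bilin _ _) lf lg. Qed.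

Lemma tmapE u v : tmap f g (u ⊗ v) = f u ⊗ g v.
Proof. exact: tliftE tmap_bilin _ _. Qed.

Lemma tmap_linear : linear (tmap f g).
Proof. exact: tlift_linear tmap_bilin. Qed.

End Tmap.

Definition tassoc U V W : (U ⊗ V) ⊗ W -> U ⊗ (V ⊗ W) :=
  tlift (fun s w => tlift (fun u v => u ⊗ (v ⊗ w)) s).

Lemma tassocE U V W (u : U) (v : V) (w : W) :
  tassoc ((u ⊗ v) ⊗ w) = u ⊗ (v ⊗ w).
Proof.
have b w' : bilin (fun (u : U) (v : V) => u ⊗ (v ⊗ (w' : W))).
  by split=> [x|x] k y z; rewrite ?tpureDl ?tpureZl ?tpureDr ?tpureZr.
rewrite /tassoc tliftE ?tliftE //; split=> [w'|s].
  exact: tlift_linear.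
elim/tensor_ind: s => [|u' v' s IHs] k x y.
  by rewrite !(linear0_ (tlift_linear (b _))) scaler0 addr0.
rewrite !(linearD_ (tlift_linear (b _))) !tliftE // IHs.
by rewrite scalerDr addrACA !tpureDr !tpureZr.
Qed.

End LinearFacts.

Arguments tassoc {K U V W}.

(** The algebra [A ⊗ B], with [(a ⊗ b) ∙ (a' ⊗ b') = (a ∙ a') ⊗ (b ∙ b')]. *)

Section TensorAlgebra.
Variables (K : fieldType) (A B : nuAlgType K).

Definition tmulc (x y : A ⊗ B) : A ⊗ B :=
  tlift (fun a b => tmap (nmul a) (nmul b) y) x.

Lemma tmulc_bilin y : bilin (fun a b => tmap (@nmul K A a) (@nmul K B b) y).
Proof.
have l (a : A) (b : B) : linear (tmap (nmul a) (nmul b)).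
  exact: (tmap_linear (nmul_linearr a) (nmul_linearr b)).
split=> [b|a] k x z.
  elim/tensor_ind: y => [|a' b' y IHy].
    by rewrite !(linear0_ (l _ _)) scaler0 addr0.
  rewrite !(linearD_ (l _ _)) IHy !tmapE; try exact: nmul_linearr.
  by rewrite nmul_linearl tpureDl tpureZl scalerDr addrACA.
elim/tensor_ind: y => [|a' b' y IHy].
  by rewrite !(linear0_ (l _ _)) scaler0 addr0.
rewrite !(linearD_ (l _ _)) IHy !tmapE; try exact: nmul_linearr.
by rewrite nmul_linearl tpureDr tpureZr scalerDr addrACA.
Qed.

Lemma tmulcE a b a' b' : tmulc (a ⊗ b) (a' ⊗ b') = (a ∙ a') ⊗ (b ∙ b').
Proof.
rewrite /tmulc (tliftE (tmulc_bilin _)) tmapE //; exact: nmul_linearr.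
Qed.

Lemma tmulc_linearl y : linear (tmulc^~ y).
Proof. exact: tlift_linear (tmulc_bilin y). Qed.

Lemma tmulc_linearr x : linear (tmulc x).
Proof.
elim/tensor_ind: x => [|a b x IHx] k y z.
  by rewrite !(linear0_ (tmulc_linearl _)) scaler0 addr0.
rewrite !(linearD_ (tmulc_linearl _)) IHx /tmulc !(tliftE (tmulc_bilin _)).
rewrite tmap_linear; try exact: nmul_linearr.
by rewrite scalerDr addrACA.
Qed.

Lemma tmulcA : associative tmulc.
Proof.
move=> x y z.
pose l1 := tmulc_linearl; pose l2 := tmulc_linearr.
elim/tensor_ind: x => [|a b x IHx]; first by rewrite !(linear0_ (l1 _)).
rewrite !(linearD_ (l1 _)) IHx; congr (_ + _).
elim/tensor_ind: y {IHx} => [|a' b' y IHy].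
  by rewrite (linear0_ (l1 _)) !(linear0_ (l2 _)) (linear0_ (l1 _)).
rewrite (linearD_ (l1 _)) !(linearD_ (l2 _)) (linearD_ (l1 _)) IHy; congr (_ + _).
elim/tensor_ind: z {IHy} => [|a'' b'' z IHz]; first by rewrite !(linear0_ (l2 _)).
by rewrite !(linearD_ (l2 _)) IHz !tmulcE !nmulA.
Qed.

HB.instance Definition _ := Lmodule_isNuAlgebra.Build K (A ⊗ B)%type
  tmulcA tmulc_linearl tmulc_linearr.

Lemma tensor_mulE (a a' : A) (b b' : B) :
  (a ⊗ b) ∙ (a' ⊗ b') = (a ∙ a') ⊗ (b ∙ b').
Proof. exact: tmulcE. Qed.

End TensorAlgebra.

(** * Multipliers *)

Record left_multiplier (K : fieldType) (A : nuAlgType K) := LeftMultiplier {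
  lm_fun :> A -> A;
  lm_linear : linear lm_fun;
  lm_mul : forall a b, lm_fun (a ∙ b) = lm_fun a ∙ b
}.

(** A multiplier [x] of [B] acts on [B] from the left, [lact x b = x b], and
    from the right, [ract x b = b x]. *)
Record multiplier (K : fieldType) (B : nuAlgType K) := Multiplier {
  lact : B -> B;
  ract : B -> B;
  lact_linear : linear lact;
  ract_linear : linear ract;
  lact_mul : forall a b, lact (a ∙ b) = lact a ∙ b;
  ract_mul : forall a b, ract (a ∙ b) = a ∙ ract b;
  act_mul : forall a b, a ∙ lact b = ract a ∙ b
}.

Arguments multiplier {K} B%_type_scope.

Section MultiplierAlgebra.
Variables (K : fieldType) (B : nuAlgType K).
Implicit Types x y z : multiplier B.

Let lin1 (b : B) := nmul_linearl b.
Let lin2 (a : B) := nmul_linearr a.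

HB.instance Definition _ := gen_eqMixin (multiplier B).
HB.instance Definition _ := gen_choiceMixin (multiplier B).

Lemma multiplier_ext x y : lact x =1 lact y -> ract x =1 ract y -> x = y.
Proof.
case: x y => [l r l1 r1 l2 r2 c] [l' r' l1' r1' l2' r2' c'] /= /funext el /funext er.
by move: l1 r1 l2 r2 c l1' r1' l2' r2' c'; rewrite el er => *; congr Multiplier;
  apply: Prop_irrelevance.
Qed.

Program Definition mzero : multiplier B :=
  @Multiplier K B (fun=> 0) (fun=> 0) _ _ _ _ _.
Next Obligation. exact: linear_zero. Qed.
Next Obligation. exact: linear_zero. Qed.
Next Obligation. by rewrite (linear0_ (lin1 _)). Qed.
Next Obligation. by rewrite (linear0_ (lin2 _)). Qed.
Next Obligation. by rewrite (linear0_ (lin1 _)) (linear0_ (lin2 _)). Qed.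

Program Definition madd x y : multiplier B :=
  @Multiplier K B (fun b => lact x b + lact y b) (fun b => ract x b + ract y b)
    _ _ _ _ _.
Next Obligation. exact: (linear_add (lact_linear x) (lact_linear y)). Qed.
Next Obligation. exact: (linear_add (ract_linear x) (ract_linear y)). Qed.
Next Obligation. by rewrite (linearD_ (lin1 _)) !lact_mul. Qed.
Next Obligation. by rewrite (linearD_ (lin2 _)) !ract_mul. Qed.
Next Obligation. by rewrite (linearD_ (lin1 _)) (linearD_ (lin2 _)) !act_mul. Qed.

Program Definition mscale k x : multiplier B :=
  @Multiplier K B (fun b => k *: lact x b) (fun b => k *: ract x b) _ _ _ _ _.
Next Obligation. exact: (linear_scale k (lact_linear x)). Qed.
Next Obligation. exact: (linear_scale k (ract_linear x)). Qed.
Next Obligation. by rewrite (linearZ_ (lin1 _)) !lact_mul. Qed.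
Next Obligation. by rewrite (linearZ_ (lin2 _)) !ract_mul. Qed.
Next Obligation. by rewrite (linearZ_ (lin1 _)) (linearZ_ (lin2 _)) !act_mul. Qed.

Program Definition mone : multiplier B := @Multiplier K B id id _ _ _ _ _.
Solve Obligations with by [].

Program Definition mmul x y : multiplier B :=
  @Multiplier K B (lact x \o lact y) (ract y \o ract x) _ _ _ _ _.
Next Obligation. exact: (linear_comp (lact_linear x) (lact_linear y)). Qed.
Next Obligation. exact: (linear_comp (ract_linear y) (ract_linear x)). Qed.
Next Obligation. by rewrite !lact_mul. Qed.
Next Obligation. by rewrite !ract_mul. Qed.
Next Obligation. by rewrite !act_mul. Qed.

Program Definition embed (b : B) : multiplier B :=
  @Multiplier K B (nmul b) (nmul^~ b) _ _ _ _ _.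
Next Obligation. by rewrite nmulA. Qed.
Next Obligation. by rewrite nmulA. Qed.
Next Obligation. by rewrite nmulA. Qed.

Lemma maddA : associative madd.
Proof. by move=> x y z; apply: multiplier_ext => b /=; rewrite addrA. Qed.
Lemma maddC : commutative madd.
Proof. by move=> x y; apply: multiplier_ext => b /=; rewrite addrC. Qed.
Lemma madd0 : left_id mzero madd.
Proof. by move=> x; apply: multiplier_ext => b /=; rewrite add0r. Qed.
Lemma maddN : left_inverse mzero (mscale (- 1)) madd.
Proof. by move=> x; apply: multiplier_ext => b /=; rewrite scaleN1r addNr. Qed.

HB.instance Definition _ :=
  GRing.isZmodule.Build (multiplier B) maddA maddC madd0 maddN.

Lemma mmulA : associative mmul.
Proof. by move=> x y z; apply: multiplier_ext. Qed.
Lemma mmul1l : left_id mone mmul.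
Proof. by move=> x; apply: multiplier_ext. Qed.
Lemma mmul1r : right_id mone mmul.
Proof. by move=> x; apply: multiplier_ext. Qed.
Lemma mmulDl : left_distributive mmul +%R.
Proof.
by move=> x y z; apply: multiplier_ext => b //=; apply: linearD_ (ract_linear z) _ _.
Qed.
Lemma mmulDr : right_distributive mmul +%R.
Proof.
by move=> x y z; apply: multiplier_ext => b //=; apply: linearD_ (lact_linear x) _ _.
Qed.

HB.instance Definition _ :=
  GRing.Zmodule_isPzRing.Build (multiplier B) mmulA mmul1l mmul1r mmulDl mmulDr.

Lemma mscaleA k l x : mscale k (mscale l x) = mscale (k * l) x.
Proof. by apply: multiplier_ext => b /=; rewrite scalerA. Qed.
Lemma mscale1 : left_id 1 mscale.
Proof. by move=> x; apply: multiplier_ext => b /=; rewrite scale1r. Qed.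
Lemma mscaleDr : right_distributive mscale +%R.
Proof. by move=> k x y; apply: multiplier_ext => b /=; rewrite scalerDr. Qed.
Lemma mscaleDl x : {morph mscale^~ x : k l / k + l}.
Proof. by move=> k l; apply: multiplier_ext => b /=; rewrite scalerDl. Qed.

HB.instance Definition _ := GRing.Zmodule_isLmodule.Build K (multiplier B)
  mscaleA mscale1 mscaleDr mscaleDl.

End MultiplierAlgebra.

(** The multiplier [x ⊗ y] of [A ⊗ B]. *)

Section MultiplierTensor.
Variables (K : fieldType) (A B : nuAlgType K).

Program Definition mtensor (x : multiplier A) (y : multiplier B) :
    multiplier (A ⊗ B)%type :=
  @Multiplier K (A ⊗ B)%type
    (tmap (lact x) (lact y)) (tmap (ract x) (ract y)) _ _ _ _ _.
Next Obligation. exact: (tmap_linear (lact_linear x) (lact_linear y)). Qed.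
Next Obligation. exact: (tmap_linear (ract_linear x) (ract_linear y)). Qed.
Next Obligation.
have l := tmap_linear (lact_linear x) (lact_linear y).
apply: (@eq_tensor K A B _ (fun a => tmap (lact x) (lact y) (a ∙ b))
  (fun a => tmap (lact x) (lact y) a ∙ b)) => [k u v|k u v|a1 a2].
- by rewrite nmul_linearl l.
- by rewrite l nmul_linearl.
apply: (@eq_tensor K A B _ (fun b => tmap (lact x) (lact y) ((a1 ⊗ a2) ∙ b))
  (fun b => tmap (lact x) (lact y) (a1 ⊗ a2) ∙ b)) => [k u v|k u v|b1 b2].
- by rewrite nmul_linearr l.
- by rewrite nmul_linearr.
have tE := tmapE (lact_linear x) (lact_linear y).
by rewrite tensor_mulE !tE tensor_mulE !lact_mul.
Qed.
Next Obligation.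
have l := tmap_linear (ract_linear x) (ract_linear y).
apply: (@eq_tensor K A B _ (fun a => tmap (ract x) (ract y) (a ∙ b))
  (fun a => a ∙ tmap (ract x) (ract y) b)) => [k u v|k u v|a1 a2].
- by rewrite nmul_linearl l.
- by rewrite nmul_linearl.
apply: (@eq_tensor K A B _ (fun b => tmap (ract x) (ract y) ((a1 ⊗ a2) ∙ b))
  (fun b => (a1 ⊗ a2) ∙ tmap (ract x) (ract y) b)) => [k u v|k u v|b1 b2].
- by rewrite nmul_linearr l.
- by rewrite l nmul_linearr.
have tE := tmapE (ract_linear x) (ract_linear y).
by rewrite tensor_mulE !tE tensor_mulE !ract_mul.
Qed.
Next Obligation.
have l1 := tmap_linear (lact_linear x) (lact_linear y).
have l2 := tmap_linear (ract_linear x) (ract_linear y).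
apply: (@eq_tensor K A B _ (fun a => a ∙ tmap (lact x) (lact y) b)
  (fun a => tmap (ract x) (ract y) a ∙ b)) => [k u v|k u v|a1 a2].
- by rewrite nmul_linearl.
- by rewrite l2 nmul_linearl.
apply: (@eq_tensor K A B _ (fun b => (a1 ⊗ a2) ∙ tmap (lact x) (lact y) b)
  (fun b => tmap (ract x) (ract y) (a1 ⊗ a2) ∙ b)) => [k u v|k u v|b1 b2].
- by rewrite l1 nmul_linearr.
- by rewrite nmul_linearr.
have tE1 := tmapE (lact_linear x) (lact_linear y).
have tE2 := tmapE (ract_linear x) (ract_linear y).
by rewrite tE1 tE2 !tensor_mulE !act_mul.
Qed.

End MultiplierTensor.

Notation "x ⊠ y" := (mtensor x y) : ring_scope.

(** [x] and [y] are equal when the algebras [B] and [B'] are identified by the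
    isomorphism [f]. *)
Definition meq_along (K : fieldType) (B B' : nuAlgType K) (f : B -> B')
    (x : multiplier B) (y : multiplier B') : Prop :=
  (forall z, f (lact x z) = lact y (f z)) /\
  (forall z, f (ract x z) = ract y (f z)).

(** * Left multiplier Hopf algebras *)

(** A chosen preimage ([0] if there is none).  It is applied to [T1], [T4], which
    are bijective, and to [embed], which is injective on [A ⊗ A] when [A] is
    non-degenerate. *)
Definition preim_of (U : zmodType) (W : Type) (f : U -> W) (w : W) : U :=
  xget 0 [set u | f u = w]%classic.

Section LeftMultiplierHopf.
Variables (K : fieldType) (A : nuAlgType K).
Variable Delta : A -> multiplier (A ⊗ A)%type.

(** [T1 (a ⊗ b) = Delta(a)(1 ⊗ b)] and [T4 (c ⊗ a) = Delta(a)(c ⊗ 1)],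
    as elements of [A ⊗ A]; see [T1_range] and [T4_range] below. *)
Definition T1 : A ⊗ A -> A ⊗ A :=
  tlift (fun a b => preim_of (@embed K _) (Delta a * (1 ⊠ embed b))).
Definition T4 : A ⊗ A -> A ⊗ A :=
  tlift (fun c a => preim_of (@embed K _) (Delta a * (embed c ⊠ 1))).

Definition T1inv : A ⊗ A -> A ⊗ A := preim_of T1.
Definition T4inv : A ⊗ A -> A ⊗ A := preim_of T4.

(** [Delta ⊗ id] and [id ⊗ Delta] on [A ⊗ A]. *)
Definition Delta_id : A ⊗ A -> multiplier ((A ⊗ A) ⊗ A)%type :=
  tlift (fun p q => Delta p ⊠ embed q).
Definition id_Delta : A ⊗ A -> multiplier (A ⊗ (A ⊗ A))%type :=
  tlift (fun p q => embed p ⊠ Delta q).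

Definition coassociative : Prop := forall a b c,
  meq_along tassoc
    (Delta_id (T1 (a ⊗ b)) * ((embed c ⊠ 1) ⊠ 1))
    (id_Delta (T4 (c ⊗ a)) * (1 ⊠ (1 ⊠ embed b))).

Record left_multiplier_hopf : Prop := LeftMultiplierHopf {
  lmh_nondegenerate : nondegenerate A;
  Delta_linear : linear Delta;
  Delta_mul : forall a b, Delta (a ∙ b) = Delta a * Delta b;
  T1_range : forall a b, exists x, Delta a * (1 ⊠ embed b) = embed x;
  T4_range : forall c a, exists x, Delta a * (embed c ⊠ 1) = embed x;
  Delta_coassociative : coassociative;
  T1_bij : bijective T1;
  T4_bij : bijective T4
}.

Definition tmul : A ⊗ A -> A := tlift (fun p q => p ∙ q).
Definition tmulop : A ⊗ A -> A := tlift (fun p q => q ∙ p).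

Definition eps_id (eps : A -> K) : A ⊗ A -> A := tlift (fun p q => eps p *: q).
Definition id_eps (eps : A -> K) : A ⊗ A -> A := tlift (fun p q => eps q *: p).

Definition is_counit (eps : A -> K) : Prop :=
  forall a b, eps a *: b = tmul (T1inv (a ⊗ b)).

Definition is_S (eps : A -> K) (S : A -> left_multiplier A) : Prop :=
  forall a b, S a b = eps_id eps (T1inv (a ⊗ b)).
Definition is_S' (eps : A -> K) (S' : A -> left_multiplier A) : Prop :=
  forall a c, S' a c = id_eps eps (T4inv (c ⊗ a)).

(** [(id ⊗ S)(x)(1 ⊗ b)] and [(S' ⊗ id)(x)(c ⊗ 1)]. *)
Definition id_S (S : A -> left_multiplier A) (b : A) : A ⊗ A -> A ⊗ A :=
  tlift (fun p q => p ⊗ S q b).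
Definition S'_id (S' : A -> left_multiplier A) (c : A) : A ⊗ A -> A ⊗ A :=
  tlift (fun p q => S' p c ⊗ q).

(** [x] is the element [((id ⊗ S)Delta(a))(1 ⊗ b)] of [A ⊗ A]. *)
Definition is_idS_Delta (S : A -> left_multiplier A) (a b : A) (x : A ⊗ A) : Prop :=
  forall c, ract (embed c ⊠ 1) x = id_S S b (T4 (c ⊗ a)).

(** [y] is the element [((S' ⊗ id)Delta(a))(c ⊗ 1)] of [A ⊗ A]. *)
Definition is_S'id_Delta (S' : A -> left_multiplier A) (a c : A) (y : A ⊗ A) : Prop :=
  forall b, ract (1 ⊠ embed b) y = S'_id S' c (T1 (a ⊗ b)).

End LeftMultiplierHopf.

(* Main.v *)
(* Coassociativity says that [T4 ⊗ ι] and [ι ⊗ T1] commute on [A ⊗ A ⊗ A].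
   Contracting the middle leg with the counit gives [(ι ⊗ ε) T4 (c ⊗ a) = a c],
   and, after inverting [T1] resp. [T4],
   [T1^-1 (a ⊗ b) (c ⊗ 1) = (ι ⊗ S)(Δ(a)(c ⊗ 1))(1 ⊗ b)] and
   [T4^-1 (c ⊗ a) (1 ⊗ b) = (S' ⊗ ι)(Δ(a)(1 ⊗ b))(c ⊗ 1)].
   So the elements sought are [T1^-1 (a ⊗ b)] and [T4^-1 (c ⊗ a)], and the
   formulas for [m] and [m^op] are the counit property.  Reading coassociativity,
   an identity of multipliers, inside the tensor cube requires tensor products of
   non-degenerate algebras to be non-degenerate; this is tested with linear
   functionals on each leg. *)

Require Import Defs.

Set Implicit Arguments.
Unset Strict Implicit.
Unset Printing Implicit Defensive.

(** * Linear functionals and non-degeneracy of tensor products *)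

Section LinearFunctionals.
Variables (K : fieldType) (U : lmodType K).

Definition subspace (M : set U) : Prop :=
  M 0 /\ forall k u v, M u -> M v -> M (k *: u + v).

(* Zorn gives a subspace maximal among those that contain [M] and avoid [p];
   by maximality it is a hyperplane complementary to the line of [p]. *)
Lemma functional_extension (M : set U) (p : U) : subspace M -> ~ M p ->
  exists phi : U -> K^o, [/\ linear phi, phi p = 1 & forall u, M u -> phi u = 0].
Proof.
move=> [M0 Mlin] Mp.
pose P : set (set U) := fun X => (X = set0 \/ (M `<=` X)%classic) /\
  (forall k u v, X u -> X v -> X (k *: u + v)) /\ ~ X p.
have [F FP Ftot|N [[PN1 [Nlin Np]] Nmax]] := @Zorn_bigcup U P.
  split.
    have [[X FX MX]|noX] := pselect (exists2 X, F X & (M `<=` X)%classic).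
      by right=> u Mu; exists X => //; apply: MX.
    left; apply/seteqP; split=> // u [X FX Xu].
    have [[X0|MX] _] := FP _ FX; first by rewrite X0 in Xu.
    by case: noX; exists X.
  split=> [k u v [X FX Xu] [Y FY Yv]|[X FX Xp]]; last by have [_ []] := FP _ FX.
  have [XY|YX] := Ftot _ _ FX FY.
    by exists Y => //; have [_ [Ylin _]] := FP _ FY; apply: Ylin => //; apply: XY.
  by exists X => //; have [_ [Xlin _]] := FP _ FX; apply: Xlin => //; apply: YX.
have MN : (M `<=` N)%classic.
  case: PN1 => // N0; case: (Nmax M); last by split; [right|split].
  by rewrite N0; split=> [//|]; move/(_ 0 M0).
have N0 : N 0 by apply: MN.
have NZ k u : N u -> N (k *: u) by move=> Nu; rewrite -[_ *: _]addr0; apply: Nlin.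
have ND u v : N u -> N v -> N (u + v) by move=> Nu /(Nlin 1 _ _ Nu); rewrite scale1r.
have NB u v : N u -> N v -> N (u - v)
  by move=> Nu Nv; apply: ND => //; rewrite -scaleN1r; apply: NZ.
(* If [u] is outside [N], the span of [N] and [u] contains [p] by maximality, say [p - k *: u] in
   [N]; [k] is nonzero because [p] is not in [N], so the relation can be solved for [u]. *)
have dec u : exists k, N (u - k *: p).
  have [Nu|Nu] := pselect (N u); first by exists 0; rewrite scale0r subr0.
  pose X : set U := fun x => exists k, N (x - k *: u).
  have NX : (N `<` X)%classic.
    split=> [x Nx|XN]; first by exists 0; rewrite scale0r subr0.
    by apply: Nu; apply: XN; exists 1; rewrite scale1r subrr.
  have Xp : X p.
    apply: contrapT => Xp; apply: (Nmax X NX); split.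
      by right=> x Mx; apply: NX.1; apply: MN.
    split=> // k x y [a Na] [b Nb]; exists (k * a + b).
    have -> : k *: x + y - (k * a + b) *: u = k *: (x - a *: u) + (y - b *: u).
      by rewrite scalerBr scalerDl scalerA opprD addrACA.
    exact: Nlin.
  have [k Nk] := Xp.
  have k0 : k != 0.
    by apply/eqP => k0; apply: Np; move: Nk; rewrite k0 scale0r subr0.
  exists k^-1; rewrite -opprB -scaleN1r; apply: (NZ (- 1)).
  by rewrite -[u](scalerK k0) -scalerBr; apply: NZ.
have uniq_dec u k l : N (u - k *: p) -> N (u - l *: p) -> k = l.
  move=> Nk Nl; apply: contrapT => /eqP; rewrite -subr_eq0 => kl; apply: Np.
  rewrite -[p](scalerK kl); apply: NZ.
  have -> : (k - l) *: p = (u - l *: p) - (u - k *: p).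
    by rewrite opprB scalerBl [RHS]addrC addrA subrK.
  exact: NB.
(* [phi u] is the coefficient of [p] in [u] modulo [N]; linearity and both values follow from its
   uniqueness. *)
have [phi phiP] := choice dec; exists phi; split=> [k u v||u Mu].
- rewrite -[RHS]/(k * phi u + phi v); apply: (@uniq_dec (k *: u + v)); first exact: phiP.
  have -> : k *: u + v - (k * phi u + phi v) *: p
          = k *: (u - phi u *: p) + (v - phi v *: p).
    by rewrite scalerBr scalerDl scalerA opprD addrACA.
  by apply: Nlin.
- by apply: (@uniq_dec p) => //; rewrite scale1r subrr.
- by apply: (@uniq_dec u) => //; rewrite scale0r subr0; apply: MN.
Qed.

Lemma functional_separation (u : U) :
  (forall phi : U -> K^o, linear phi -> phi u = 0) -> u = 0.
Proof.
move=> phiu; apply: contrapT => u0.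
have [|phi [lphi phi1 _]] := @functional_extension (fun x => x = 0) u _ u0.
  by split=> // k _ _ -> ->; rewrite scaler0 addr0.
by have /eqP := phiu _ lphi; rewrite phi1 oner_eq0.
Qed.

End LinearFunctionals.

(** * Slice maps and separation of tensors *)

Section Slices.
Variable K : fieldType.
Implicit Types U V : lmodType K.

(** The maps φ ⊗ ι and ι ⊗ ψ, with the scalar leg absorbed. At the counit they unfold to [eps_id]
    and [id_eps]. *)
Definition lslice U V (phi : U -> K^o) : U ⊗ V -> V := tlift (fun u v => phi u *: v).
Definition rslice U V (psi : V -> K^o) : U ⊗ V -> U := tlift (fun u v => psi v *: u).

Lemma lslice_bilin U V (phi : U -> K^o) :
  linear phi -> bilin (fun u (v : V) => phi u *: v).
Proof.
move=> lphi; split=> [v|u] k x y; first by rewrite lphi scalerDl scalerA.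
by rewrite scalerDr !scalerA mulrC.
Qed.

Lemma rslice_bilin U V (psi : V -> K^o) :
  linear psi -> bilin (fun (u : U) v => psi v *: u).
Proof.
move=> lpsi; split=> [v|u] k x y; last by rewrite lpsi scalerDl scalerA.
by rewrite scalerDr !scalerA mulrC.
Qed.

Section Functional.
Variables (U V : lmodType K) (phi : U -> K^o) (psi : V -> K^o).
Hypotheses (lphi : linear phi) (lpsi : linear psi).

Lemma lslice_linear : linear (@lslice U V phi).
Proof. exact: (tlift_linear (@lslice_bilin U V phi lphi)). Qed.
Lemma rslice_linear : linear (@rslice U V psi).
Proof. exact: (tlift_linear (@rslice_bilin U V psi lpsi)). Qed.
Lemma lsliceE u v : @lslice U V phi (u ⊗ v) = phi u *: v.
Proof. exact: (tliftE (@lslice_bilin U V phi lphi) u v). Qed.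
Lemma rsliceE u v : @rslice U V psi (u ⊗ v) = psi v *: u.
Proof. exact: (tliftE (@rslice_bilin U V psi lpsi) u v). Qed.

(** On pure tensors both sides are φ(u)ψ(v). *)
Lemma slice_slice (x : U ⊗ V) : phi (rslice psi x) = psi (lslice phi x).
Proof.
apply: (@eq_tensor K U V K^o (fun x => phi (rslice psi x))
  (fun x => psi (lslice phi x))) => [||u v].
- exact: linear_comp lphi rslice_linear.
- exact: linear_comp lpsi lslice_linear.
by rewrite lsliceE rsliceE (linearZ_ lphi) (linearZ_ lpsi); apply: mulrC.
Qed.

End Functional.

Section SliceMap.
Variables (U V U' V' : lmodType K) (f : U -> U') (g : V -> V').
Hypotheses (lf : linear f) (lg : linear g).

Lemma rslice_tmap (psi : V' -> K^o) x : linear psi ->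
  rslice psi (tmap f g x) = f (rslice (psi \o g) x).
Proof.
move=> lpsi; have lpsig := linear_comp lpsi lg.
apply: (@eq_tensor K U V U' (fun x => rslice psi (tmap f g x))
  (fun x => f (rslice (psi \o g) x))) => [||u v].
- exact: linear_comp (rslice_linear lpsi) (tmap_linear lf lg).
- exact: linear_comp lf (rslice_linear lpsig).
by rewrite (tmapE lf lg) !rsliceE // (linearZ_ lf).
Qed.

End SliceMap.

Section Separation.
Variables U V : lmodType K.

(** Prescribing the first legs, and not just the number of terms, makes these tensors a subspace and
    permits induction on [s] without choosing bases. *)
Fixpoint sums_over (s : seq U) (x : U ⊗ V) : Prop :=
  if s is p :: s' then exists v y, sums_over s' y /\ x = p ⊗ v + y else x = 0.

Lemma sums_over0 s : sums_over s 0.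
Proof.
elim: s => //= p s IHs; exists 0, 0; split=> //.
by rewrite addr0 -(scale0r (0 : V)) tpureZr scale0r.
Qed.

Lemma sums_over_lin s k x y :
  sums_over s x -> sums_over s y -> sums_over s (k *: x + y).
Proof.
elim: s x y => [|p s IHs] x y /=; first by move=> -> ->; rewrite scaler0 addr0.
move=> [v [x' [sx ->]]] [w [y' [sy ->]]].
exists (k *: v + w), (k *: x' + y'); split; first exact: IHs.
by rewrite scalerDr tpureDr tpureZr addrACA.
Qed.

Lemma sums_over_pure s p v : p \in s -> sums_over s (p ⊗ v).
Proof.
elim: s => //= q s IHs; rewrite inE => /orP[/eqP ->|ps].
  by exists v, 0; rewrite addr0; split=> //; apply: sums_over0.
exists 0, (p ⊗ v); split; first exact: IHs.
by rewrite -(scale0r (0 : V)) tpureZr scale0r add0r.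
Qed.

Lemma lslice_sums_over s (phi : U -> K^o) x : linear phi ->
  (forall p, p \in s -> phi p = 0) -> sums_over s x -> lslice phi x = 0.
Proof.
move=> lphi; elim: s x => [|p s IHs] x phi0 /=.
  by move=> ->; rewrite (linear0_ (lslice_linear lphi)).
move=> [v [y [sy ->]]]; rewrite (linearD_ (lslice_linear lphi)) lsliceE //.
rewrite phi0 ?mem_head // scale0r add0r IHs // => q qs.
by apply: phi0; rewrite inE qs orbT.
Qed.

(** Induction on a list of first legs of [x]. The leg [p] is either redundant, or separated from the
    remaining ones by a functional whose slice of [x] is the coefficient [v], which is therefore
    zero. *)
Lemma lslice_separation (x : U ⊗ V) :
  (forall phi : U -> K^o, linear phi -> lslice phi x = 0) -> x = 0.
Proof.
have [s] : exists s, sums_over s x.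
  elim/tensor_ind: x => [|u v x [s sx]]; first by exists [::].
  by exists (u :: s), v, x.
elim: s x => [//|p s IHs] x /= [v [y [sy ->]]] slice0.
have [sp|nsp] := pselect (forall w : V, sums_over s (p ⊗ w)).
  by apply: IHs slice0; rewrite -[p ⊗ v]scale1r; apply: sums_over_lin.
(* This subspace stands in for the span of [s]: it contains every entry of [s], and it omits [p] by
   the case assumption. *)
have [|phi [lphi phip phi0]] := @functional_extension K U
    (fun u => forall w : V, sums_over s (u ⊗ w)) p _ nsp.
  split=> [w|k u u' su su' w].
    by rewrite -(scale0r (0 : U)) tpureZl scale0r; apply: sums_over0.
  by rewrite tpureDl tpureZl; apply: sums_over_lin.
have y0 : lslice phi y = 0.
  apply: lslice_sums_over sy => // q qs; apply: phi0 => w.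
  exact: sums_over_pure.
have v0 : v = 0.
  have := slice0 phi lphi.
  by rewrite (linearD_ (lslice_linear lphi)) lsliceE // y0 phip scale1r addr0.
have pv0 : p ⊗ v = 0 by rewrite v0 -(scale0r (0 : V)) tpureZr scale0r.
by rewrite pv0 add0r in slice0 *; apply: IHs.
Qed.

(** A functional with value 1 at a nonzero [u] slices [u ⊗ v] to [v]. *)
Lemma tpure_eq0 (u : U) (v : V) : u ⊗ v = 0 -> u = 0 \/ v = 0.
Proof.
move=> uv0; have [->|/eqP u0] := pselect (u = 0); [by left|right].
have [|phi [lphi phi1 _]] := @functional_extension K U (fun x => x = 0) u _ (elimN eqP u0).
  by split=> // k _ _ -> ->; rewrite scaler0 addr0.
by rewrite -[v]scale1r -phi1 -lsliceE // uv0 (linear0_ (lslice_linear lphi)).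
Qed.

End Separation.
End Slices.

(** * Faithfulness of tensor products of algebras *)

Definition right_faithful (K : fieldType) (A : nuAlgType K) : Prop :=
  forall a : A, (forall b, a ∙ b = 0) -> a = 0.

(** Slicing [x ∙ (a ⊗ b) = 0] in the second leg and cancelling [a] kills the slices of [x] by
    [psi \o nmul^~ b]. Exchanging slices, every [psi] vanishes on [lslice phi x ∙ b]; hence all left
    slices of [x] are zero. *)
Lemma right_faithful_tensor (K : fieldType) (A B : nuAlgType K) :
  right_faithful A -> right_faithful B -> right_faithful (A ⊗ B)%type.
Proof.
move=> fA fB x x0.
have mulE a b : x ∙ (a ⊗ b) = tmap (nmul^~ a) (nmul^~ b) x.
  apply: (@eq_tensor K A B _ (fun x => x ∙ (a ⊗ b)) (tmap (nmul^~ a) (nmul^~ b))).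
  - exact: nmul_linearl.
  - exact: tmap_linear (nmul_linearl a) (nmul_linearl b).
  by move=> a' b'; rewrite tensor_mulE tmapE //; apply: nmul_linearl.
have rslice0 (psi : B -> K^o) b : linear psi -> rslice (psi \o nmul^~ b) x = 0.
  move=> lpsi; apply: fA => a.
  have <- := rslice_tmap (nmul_linearl a) (nmul_linearl b) x lpsi.
  by rewrite -mulE x0 (linear0_ (rslice_linear lpsi)).
apply: lslice_separation => phi lphi; apply: fB => b.
apply: functional_separation => psi lpsi.
have lpsib : linear (psi \o nmul^~ b) := linear_comp lpsi (nmul_linearl b).
by rewrite -[LHS](slice_slice lphi lpsib) rslice0 // (linear0_ lphi).
Qed.

Lemma embed_inj (K : fieldType) (B : nuAlgType K) :
  right_faithful B -> injective (@embed K B).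
Proof.
move=> fB x y xy; apply/eqP; rewrite -subr_eq0; apply/eqP; apply: fB => b.
have /= := congr1 (fun z => lact z b) xy.
rewrite (linearD_ (nmul_linearl b)) -scaleN1r (linearZ_ (nmul_linearl b)) scaleN1r => ->.
by rewrite subrr.
Qed.

(** * Associativity of tensor products *)

Section TensorMaps.
Variable K : fieldType.
Implicit Types U V W : lmodType K.

Lemma linear_id U : linear (@id U).
Proof. by []. Qed.

Lemma tpure_linearl U V (v : V) : linear (fun u : U => u ⊗ v).
Proof. exact: (@tpure_bilin K U V).1. Qed.

Lemma tpure_linearr U V (u : U) : linear (fun v : V => u ⊗ v).
Proof. exact: (@tpure_bilin K U V).2. Qed.

Lemma tmap_comp U V U1 V1 U2 V2 (f : U1 -> U2) (g : V1 -> V2) (f' : U -> U1)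
    (g' : V -> V1) : linear f -> linear g -> linear f' -> linear g' ->
  forall x, tmap f g (tmap f' g' x) = tmap (f \o f') (g \o g') x.
Proof.
move=> lf lg lf' lg'; have lff := linear_comp lf lf'; have lgg := linear_comp lg lg'.
apply: (@eq_tensor K U V _ (fun x => tmap f g (tmap f' g' x))) => [||u v].
- exact: linear_comp (tmap_linear lf lg) (tmap_linear lf' lg').
- exact: tmap_linear.
by rewrite !tmapE.
Qed.

Lemma eq_tmap U V U' V' (f f' : U -> U') (g g' : V -> V') :
  f =1 f' -> g =1 g' -> tmap f g = tmap f' g'.
Proof. by move=> /funext -> /funext ->. Qed.

Lemma tassoc_linear U V W : linear (@tassoc K U V W).
Proof.
have b w : bilin (fun (u : U) (v : V) => u ⊗ (v ⊗ (w : W))).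
  by split=> [x|x] k y z; rewrite ?tpureDl ?tpureZl ?tpureDr ?tpureZr.
apply: tlift_linear; split=> [w|s]; first exact: tlift_linear.
move=> k w w'.
apply: (@eq_tensor K U V _ (fun s => tlift _ s)
  (fun s => k *: tlift (fun u v => u ⊗ (v ⊗ w)) s + tlift (fun u v => u ⊗ (v ⊗ w')) s))
  => [||u v]; try by apply: tlift_linear.
  by apply: linear_add; [apply: linear_scale|]; apply: tlift_linear.
by rewrite !tliftE // !tpureDr !tpureZr.
Qed.

(** The inverse of [tassoc], as [tdissocK] and [tassocK] show; it transports coassociativity between
    the two bracketings. *)
Definition tdissoc U V W : U ⊗ (V ⊗ W) -> (U ⊗ V) ⊗ W :=
  tlift (fun u => tmap (fun v => u ⊗ v) id).

Lemma tdissoc_bilin U V W :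
  bilin (fun (u : U) => tmap (fun v : V => u ⊗ v) (@id W)).
Proof.
have l (u : U) := tmap_linear (tpure_linearr (V := V) u) (@linear_id W).
split=> [y|u]; last exact: l.
move=> k u u'.
apply: (@eq_tensor K V W _ (tmap (fun v => (k *: u + u') ⊗ v) id)
  (fun y => k *: tmap (fun v => u ⊗ v) id y + tmap (fun v => u' ⊗ v) id y)) => [||v w].
- exact: l.
- by apply: linear_add; [apply: linear_scale|]; apply: l.
rewrite !tmapE //; try exact: tpure_linearr.
by rewrite !tpureDl !tpureZl.
Qed.

Lemma tdissoc_linear U V W : linear (@tdissoc U V W).
Proof. exact: tlift_linear (@tdissoc_bilin U V W). Qed.

Lemma tdissocE U V W (u : U) (y : V ⊗ W) :
  tdissoc (u ⊗ y) = tmap (fun v => u ⊗ v) id y.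
Proof. exact: tliftE (@tdissoc_bilin U V W) _ _. Qed.

Lemma tassocEr U V W (u : U) (y : V ⊗ W) :
  tassoc (tmap (fun v => u ⊗ v) id y) = u ⊗ y.
Proof.
have l := tmap_linear (tpure_linearr (V := V) u) (@linear_id W).
apply: (@eq_tensor K V W _ (fun y => tassoc (tmap (fun v => u ⊗ v) id y))
  (fun y => u ⊗ y)) => [||v w].
- exact: linear_comp (@tassoc_linear U V W) l.
- exact: tpure_linearr.
rewrite tmapE ?tassocE //; exact: tpure_linearr.
Qed.

Lemma tdissocK U V W : cancel (@tdissoc U V W) tassoc.
Proof.
apply: (@eq_tensor K U _ _ (fun y => tassoc (tdissoc y)) id) => [||u y] //.
  exact: linear_comp (@tassoc_linear U V W) (@tdissoc_linear U V W).
by rewrite tdissocE tassocEr.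
Qed.

Lemma tassocEl U V W (t : U ⊗ V) (w : W) :
  tassoc (t ⊗ w) = tmap id (fun v => v ⊗ w) t.
Proof.
have l := tmap_linear (@linear_id U) (tpure_linearl (U := V) w).
apply: (@eq_tensor K U V _ (fun t => tassoc (t ⊗ w))
  (tmap id (fun v => v ⊗ w))) => [||u v] //.
  exact: linear_comp (@tassoc_linear U V W) (tpure_linearl w).
rewrite tmapE ?tassocE //; exact: tpure_linearl.
Qed.

Lemma tassocK U V W : cancel (@tassoc K U V W) (@tdissoc U V W).
Proof.
apply: (@eq_tensor K _ W _ (fun y => tdissoc (tassoc y)) id) => [||t w] //.
  exact: linear_comp (@tdissoc_linear U V W) (@tassoc_linear U V W).
apply: (@eq_tensor K U V _ (fun t => tdissoc (tassoc (t ⊗ w)))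
  (fun t => t ⊗ w)) => [||u v].
- apply: linear_comp (@tdissoc_linear U V W) _.
  exact: linear_comp (@tassoc_linear U V W) (tpure_linearl w).
- exact: tpure_linearl.
by rewrite tassocE tdissocE tmapE //; apply: tpure_linearr.
Qed.

(** Both sides contract the middle leg, which is insensitive to bracketing; this allows the counit
    to be applied to both sides of coassociativity. *)
Lemma tmap_lslice_assoc U V W (phi : V -> K^o) : linear phi ->
  forall y : (U ⊗ V) ⊗ W, tmap id (lslice phi) (tassoc y) = tmap (rslice phi) id y.
Proof.
move=> lphi; have ll := lslice_linear (V := W) lphi; have lr := rslice_linear (U := U) lphi.
have l1 := tmap_linear (@linear_id U) ll; have l2 := tmap_linear lr (@linear_id W).
apply: (@eq_tensor K _ W _ (fun y => tmap id (lslice phi) (tassoc y))) => [||t w] //.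
  exact: linear_comp l1 (@tassoc_linear U V W).
rewrite tassocEl tmap_comp //; last exact: tpure_linearl.
rewrite tmapE //.
apply: (@eq_tensor K U V _ _ (fun t => rslice phi t ⊗ w)) => [||u v].
- by apply: tmap_linear => //; apply: linear_comp ll (tpure_linearl w).
- exact: linear_comp (tpure_linearl w) lr.
rewrite tmapE //; last by apply: linear_comp ll (tpure_linearl w).
by rewrite /= lsliceE // rsliceE // tpureZl tpureZr.
Qed.

End TensorMaps.

(** * Multiplication and multipliers on tensor products *)

Section TensorAlgebras.
Variable K : fieldType.
Implicit Types A B C : nuAlgType K.

Lemma tassoc_mul A B C (x y : (A ⊗ B) ⊗ C) : tassoc (x ∙ y) = tassoc x ∙ tassoc y.
Proof.
have l := @tassoc_linear K A B C.
elim/tensor_ind: x => [|t c x IHx].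
  by rewrite !(linear0_ l, linear0_ (nmul_linearl _)).
rewrite !(linearD_ l, linearD_ (nmul_linearl _)) IHx; congr (_ + _).
elim/tensor_ind: y {IHx} => [|t' c' y IHy].
  by rewrite !(linear0_ l, linear0_ (nmul_linearr _)).
rewrite !(linearD_ l, linearD_ (nmul_linearr _)) IHy; congr (_ + _).
elim/tensor_ind: t {IHy} => [|a b t IHt].
  rewrite (linear0_ (tpure_linearl _)) !(linear0_ l, linear0_ (nmul_linearl _)) //.
rewrite !(linearD_ (tpure_linearl _), linearD_ l, linearD_ (nmul_linearl _)) IHt.
congr (_ + _).
elim/tensor_ind: t' {IHt} => [|a' b' t' IHt].
  rewrite (linear0_ (tpure_linearl _)) !(linear0_ l, linear0_ (nmul_linearr _)) //.
rewrite !(linearD_ (tpure_linearl _), linearD_ l, linearD_ (nmul_linearr _)) IHt.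
by rewrite !tensor_mulE !tassocE !tensor_mulE.
Qed.

Lemma embed_linear B : linear (@embed K B).
Proof.
move=> k a b; apply: multiplier_ext => c /=.
  by rewrite nmul_linearl.
by rewrite nmul_linearr.
Qed.

(** Linearity in the parameter is checked on pure tensors. [mtensor_bilin] uses this with one of the
    two families constant. *)
Lemma tmap_linear_arg (U V U' V' : lmodType K) (F : lmodType K)
    (f : F -> U -> U') (g : F -> V -> V') :
  (forall t, linear (f t)) -> (forall t, linear (g t)) ->
  (forall u v, linear (fun t => f t u ⊗ g t v)) ->
  forall x, linear (fun t => tmap (f t) (g t) x).
Proof.
move=> lf lg lfg x k s t.
apply: (@eq_tensor K U V _ (fun x => tmap (f (k *: s + t)) (g (k *: s + t)) x)
  (fun x => k *: tmap (f s) (g s) x + tmap (f t) (g t) x)) => [||u v].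
- exact: tmap_linear.
- by apply: linear_add; [apply: linear_scale|]; apply: tmap_linear.
by rewrite !tmapE //; apply: lfg.
Qed.

Lemma mtensor_bilin A B : bilin (@mtensor K A B).
Proof.
split=> [y|x] k s t; apply: multiplier_ext => z.
- apply: (@tmap_linear_arg A B A B (multiplier A) (fun x => lact x) (fun=> lact y)).
  + exact: lact_linear.
  + by move=> _; apply: lact_linear.
  + by move=> u v c p q /=; rewrite tpureDl tpureZl.
- apply: (@tmap_linear_arg A B A B (multiplier A) (fun x => ract x) (fun=> ract y)).
  + exact: ract_linear.
  + by move=> _; apply: ract_linear.
  + by move=> u v c p q /=; rewrite tpureDl tpureZl.
- apply: (@tmap_linear_arg A B A B (multiplier B) (fun=> lact x) (fun y => lact y)).
  + by move=> _; apply: lact_linear.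
  + exact: lact_linear.
  + by move=> u v c p q /=; rewrite tpureDr tpureZr.
- apply: (@tmap_linear_arg A B A B (multiplier B) (fun=> ract x) (fun y => ract y)).
  + by move=> _; apply: ract_linear.
  + exact: ract_linear.
  + by move=> u v c p q /=; rewrite tpureDr tpureZr.
Qed.

Lemma right_faithful_cancel A (x y : A) :
  right_faithful A -> (forall z, x ∙ z = y ∙ z) -> x = y.
Proof.
move=> fA xy; apply/eqP; rewrite -subr_eq0; apply/eqP; apply: fA => b.
by rewrite (linearD_ (nmul_linearl b)) xy -scaleN1r (linearZ_ (nmul_linearl b)) scaleN1r subrr.
Qed.

End TensorAlgebras.

(** * Chosen preimages and inverses *)

Lemma preim_ofK (U : zmodType) (W : Type) (f : U -> W) (w : W) :
  (exists u, f u = w) -> f (preim_of f w) = w.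
Proof. by move=> [u fu]; apply: (@xgetPex _ 0 [set v | f v = w]%classic); exists u. Qed.

Lemma bij_preim_of (U W : zmodType) (f : U -> W) :
  bijective f -> cancel f (preim_of f) /\ cancel (preim_of f) f.
Proof.
move=> [g fK gK]; have pK : cancel (preim_of f) f.
  by move=> w; apply: preim_ofK; exists (g w).
by split=> // u; apply: (can_inj fK); rewrite pK.
Qed.

Lemma linear_inverse (K : fieldType) (U W : lmodType K) (f : U -> W) (g : W -> U) :
  linear f -> cancel f g -> cancel g f -> linear g.
Proof. by move=> lf fK gK k x y; apply: (can_inj fK); rewrite lf !gK. Qed.

(** * The maps [T1] and [T4] *)

Section Hopf.
Variables (K : fieldType) (A : nuAlgType K) (Delta : A -> multiplier (A ⊗ A)%type).
Hypothesis hA : left_multiplier_hopf Delta.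

Let fA : right_faithful A := (lmh_nondegenerate hA).1.
Let fAA : right_faithful (A ⊗ A)%type := right_faithful_tensor fA fA.


(** The multiplier is linear in [a] and in [b], and [embed] is linear and injective on [A ⊗ A], so
    the chosen preimages inherit bilinearity. *)
Lemma T1_bilin : bilin (fun a b => preim_of (@embed K _) (Delta a * (1 ⊠ embed b))).
Proof.
have E a b : embed (preim_of (@embed K _) (Delta a * (1 ⊠ embed b))) = Delta a * (1 ⊠ embed b).
  by rewrite preim_ofK //; have [x ->] := T1_range hA a b; exists x.
have [_ lr] := @mtensor_bilin K A A.
split=> [b|a] k x y; apply: (embed_inj fAA); rewrite [RHS]embed_linear !E.
  by rewrite (Delta_linear hA); apply: multiplier_ext => z //; apply: ract_linear.
by rewrite embed_linear lr; apply: multiplier_ext => z //; apply: lact_linear.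
Qed.

Lemma T4_bilin : bilin (fun c a => preim_of (@embed K _) (Delta a * (embed c ⊠ 1))).
Proof.
have E c a : embed (preim_of (@embed K _) (Delta a * (embed c ⊠ 1))) = Delta a * (embed c ⊠ 1).
  by rewrite preim_ofK //; have [x ->] := T4_range hA c a; exists x.
have [ll _] := @mtensor_bilin K A A.
split=> [a|c] k x y; apply: (embed_inj fAA); rewrite [RHS]embed_linear !E.
  by rewrite embed_linear ll; apply: multiplier_ext => z //; apply: lact_linear.
by rewrite (Delta_linear hA); apply: multiplier_ext => z //; apply: ract_linear.
Qed.

Lemma T1_linear : linear (T1 Delta).
Proof. exact: tlift_linear T1_bilin. Qed.
Lemma T4_linear : linear (T4 Delta).
Proof. exact: tlift_linear T4_bilin. Qed.

Lemma embed_T1 a b : embed (T1 Delta (a ⊗ b)) = Delta a * (1 ⊠ embed b).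
Proof.
by rewrite /T1 (tliftE T1_bilin) preim_ofK //; have [x ->] := T1_range hA a b; exists x.
Qed.
Lemma embed_T4 c a : embed (T4 Delta (c ⊗ a)) = Delta a * (embed c ⊠ 1).
Proof.
by rewrite /T4 (tliftE T4_bilin) preim_ofK //; have [x ->] := T4_range hA c a; exists x.
Qed.

(** The left action of [embed_T1]: in this form identities of multipliers turn into identities
    between elements of tensor powers. *)
Lemma T1_mul a b z : T1 Delta (a ⊗ b) ∙ z = lact (Delta a) (tmap id (nmul b) z).
Proof. exact: (congr1 (fun x => lact x z) (embed_T1 a b)). Qed.
Lemma T4_mul c a z : T4 Delta (c ⊗ a) ∙ z = lact (Delta a) (tmap (nmul c) id z).
Proof. exact: (congr1 (fun x => lact x z) (embed_T4 c a)). Qed.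

Lemma T1K : cancel (T1 Delta) (T1inv Delta).
Proof. exact: (bij_preim_of (T1_bij hA)).1. Qed.
Lemma T1invK : cancel (T1inv Delta) (T1 Delta).
Proof. exact: (bij_preim_of (T1_bij hA)).2. Qed.
Lemma T4K : cancel (T4 Delta) (T4inv Delta).
Proof. exact: (bij_preim_of (T4_bij hA)).1. Qed.
Lemma T4invK : cancel (T4inv Delta) (T4 Delta).
Proof. exact: (bij_preim_of (T4_bij hA)).2. Qed.

Lemma T1inv_linear : linear (T1inv Delta).
Proof. exact: linear_inverse T1_linear T1K T1invK. Qed.
Lemma T4inv_linear : linear (T4inv Delta).
Proof. exact: linear_inverse T4_linear T4K T4invK. Qed.

Lemma T1_linearl b : linear (fun s => T1 Delta (s ⊗ b)).
Proof. exact: linear_comp T1_linear (tpure_linearl b). Qed.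
Lemma T4_linearr c : linear (fun p => T4 Delta (c ⊗ p)).
Proof. exact: linear_comp T4_linear (tpure_linearr c). Qed.

Let LA (b : A) : linear (nmul b) := nmul_linearr b.
Let RA (b : A) : linear (nmul^~ b) := nmul_linearl b.

(* [Delta(a)(c ⊗ 1)(1 ⊗ b) = Delta(a)(1 ⊗ b)(c ⊗ 1)] *)
Lemma T4_T1_mul a b c :
  tmap id (nmul^~ b) (T4 Delta (c ⊗ a)) = tmap (nmul^~ c) id (T1 Delta (a ⊗ b)).
Proof.
have lid := @linear_id K A.
have rl x : tmap id (nmul^~ b) x = ract (1 ⊠ embed b) x by [].
have rr x : tmap (nmul^~ c) id x = ract (embed c ⊠ 1) x by [].
apply: (right_faithful_cancel fAA) => z.
(* [act_mul] moves the right multiplications onto [z]; both sides become Δ(a) applied to (c ⊗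
   b)z. *)
rewrite rl rr -!act_mul T1_mul T4_mul /= !tmap_comp //.
Qed.

(** Multiplying an arbitrary [z] by either side gives the action of the corresponding multiplier in
    [coassociative]; faithfulness of the tensor cube then cancels [z]. *)
Lemma coassoc_T a b c :
  tassoc (tmap (fun p => T4 Delta (c ⊗ p)) id (T1 Delta (a ⊗ b))) =
  tmap id (fun s => T1 Delta (s ⊗ b)) (T4 Delta (c ⊗ a)).
Proof.
have lid := @linear_id K A.
have lT1 := T1_linearl b; have lT4 := T4_linearr c.
have lDi : linear (Delta_id Delta).
  apply: tlift_linear; apply: bilin_comp (Delta_linear hA) (@embed_linear K A).
  exact: mtensor_bilin.
have liD : linear (id_Delta Delta).
  apply: tlift_linear; apply: bilin_comp (@embed_linear K A) (Delta_linear hA).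
  exact: mtensor_bilin.
(* On a pure tensor this is (Δ(p) ⊗ q)(c ⊗ 1 ⊗ 1) = Δ(p)(c ⊗ 1) ⊗ q; [right_mul] is its mirror
   image. *)
have left_mul x z : lact (Delta_id Delta x * ((embed c ⊠ 1) ⊠ 1)) z
                  = tmap (fun p => T4 Delta (c ⊗ p)) id x ∙ z.
  apply: (@eq_tensor K A A _ (fun x => lact (Delta_id Delta x) (lact ((embed c ⊠ 1) ⊠ 1) z))
    (fun x => tmap (fun p => T4 Delta (c ⊗ p)) id x ∙ z)) => [k u v|k u v|p q].
  - by rewrite lDi.
  - by rewrite tmap_linear // nmul_linearl.
  rewrite /Delta_id (tliftE (bilin_comp (@mtensor_bilin K _ _)
    (Delta_linear hA) (@embed_linear K A))).
  rewrite tmapE //; move: z; apply: eq_tensor => [||t w].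
  - exact: linear_comp (@lact_linear _ _ _) (@lact_linear _ _ _).
  - exact: nmul_linearr.
  rewrite /= tmapE //; last exact: tmap_linear.
  rewrite tmapE //; last exact: lact_linear.
  by rewrite -T4_mul; apply/esym; apply: (@tensor_mulE K (A ⊗ A)%type A).
have right_mul x z : lact (id_Delta Delta x * (1 ⊠ (1 ⊠ embed b))) z
                  = tmap id (fun s => T1 Delta (s ⊗ b)) x ∙ z.
  apply: (@eq_tensor K A A _ (fun x => lact (id_Delta Delta x) (lact (1 ⊠ (1 ⊠ embed b)) z))
    (fun x => tmap id (fun s => T1 Delta (s ⊗ b)) x ∙ z)) => [k u v|k u v|p q].
  - by rewrite liD.
  - by rewrite tmap_linear // nmul_linearl.
  rewrite /id_Delta (tliftE (bilin_comp (@mtensor_bilin K _ _)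
    (@embed_linear K A) (Delta_linear hA))).
  rewrite tmapE //; move: z; apply: eq_tensor => [||w t].
  - exact: linear_comp (@lact_linear _ _ _) (@lact_linear _ _ _).
  - exact: nmul_linearr.
  rewrite /= tmapE //; last exact: tmap_linear.
  rewrite tmapE //; last exact: lact_linear.
  by rewrite -T1_mul; apply/esym; apply: (@tensor_mulE K A (A ⊗ A)%type).
apply: (right_faithful_cancel (right_faithful_tensor fA fAA)) => z.
(* With [z] in the image of [tassoc], which is multiplicative, both sides take the form compared by
   [meq_along]. *)
rewrite -(tdissocK z) -tassoc_mul -left_mul -right_mul.
exact: (Delta_coassociative hA a b c).1.
Qed.

(** * The counit and the inverses of [T1] and [T4] *)

Section Counit.
Variable eps : A -> K^o.
Hypotheses (leps : linear eps) (heps : is_counit Delta eps).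

Let lid := @linear_id K A.
Let ll : linear (@lslice K A A eps) := lslice_linear leps.
Let lr : linear (@rslice K A A eps) := rslice_linear leps.

Lemma tmul_bilin : bilin (fun p q : A => p ∙ q).
Proof. by split=> [q|p]; [apply: RA|apply: LA]. Qed.

Lemma tmulop_bilin : bilin (fun p q : A => q ∙ p).
Proof. by split=> [q|p]; [apply: LA|apply: RA]. Qed.

Lemma tmul_linear : linear (@tmul K A).
Proof. exact: tlift_linear tmul_bilin. Qed.

Lemma tmulop_linear : linear (@tmulop K A).
Proof. exact: tlift_linear tmulop_bilin. Qed.

(** By linearity [heps] says that ε ⊗ ι is m composed with the inverse of [T1]; evaluate at
    [T1 (a ⊗ b)]. *)
Lemma counit_T1 a b : lslice eps (T1 Delta (a ⊗ b)) = a ∙ b.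
Proof.
rewrite -(tliftE tmul_bilin a b) -/(tmul _) -[in RHS](T1K (a ⊗ b)).
move: (T1 Delta _); apply: eq_tensor => [||p q] //.
  exact: linear_comp tmul_linear T1inv_linear.
by rewrite lsliceE // heps.
Qed.

(** Contracting the middle leg of coassociativity shows that the two maps of [p] agree after
    tensoring with ι; the second leg is then cancelled. *)
Lemma counit_T4 c p : rslice eps (T4 Delta (c ⊗ p)) = p ∙ c.
Proof.
have lF : linear (fun p => rslice eps (T4 Delta (c ⊗ p))).
  exact: linear_comp lr (T4_linearr c).
have key (x : A ⊗ A) : tmap (fun p => rslice eps (T4 Delta (c ⊗ p))) id x = tmap (nmul^~ c) id x.
  (* Surjectivity of [T1] reduces the claim to [x = T1 (a ⊗ b)], where [coassoc_T] applies. *)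
  rewrite -(T1invK x); move: (T1inv Delta x); apply: eq_tensor => [||a b].
  - exact: linear_comp (tmap_linear lF lid) T1_linear.
  - exact: linear_comp (tmap_linear (RA c) lid) T1_linear.
  have := congr1 (tmap id (lslice eps)) (coassoc_T a b c).
  rewrite tmap_lslice_assoc // !tmap_comp //; try exact: T1_linearl; try exact: T4_linearr.
  rewrite (@eq_tmap K _ _ _ _ (id \o id) id (lslice eps \o _) (nmul^~ b)) //.
    by rewrite T4_T1_mul.
  by move=> s; apply: counit_T1.
apply/eqP; rewrite -subr_eq0; apply/eqP.
(* The difference serves as its own second leg: [key] gives [u ⊗ u = 0], so no nonzero vector of [A]
   has to be supplied. *)
set u := _ - _.
have [] := @tpure_eq0 K A A u u => //.
have := key (p ⊗ u); rewrite !tmapE // => e.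
rewrite {1}/u -scaleN1r tpureDl tpureZl scaleN1r; apply/eqP; rewrite subr_eq0; exact/eqP.
Qed.

(** [counit_T4] says that m^op is (ι ⊗ ε) composed with [T4]; evaluate at the inverse image of
    [c ⊗ a]. *)
Lemma counit_T4inv c a : tmulop (T4inv Delta (c ⊗ a)) = eps a *: c.
Proof.
rewrite -(rsliceE leps c a) -[in RHS](T4invK (c ⊗ a)).
move: (T4inv Delta _); apply: eq_tensor => [||p q].
- exact: tmulop_linear.
- exact: linear_comp lr T4_linear.
by rewrite counit_T4 /tmulop (tliftE tmulop_bilin).
Qed.

(* Apply [ι ⊗ T1^-1] to coassociativity and contract the middle leg with [eps]. *)
Lemma T1inv_mulr a b c :
  tmap (nmul^~ c) id (T1inv Delta (a ⊗ b)) =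
  tmap id (fun q => lslice eps (T1inv Delta (q ⊗ b))) (T4 Delta (c ⊗ a)).
Proof.
have lh : linear (lslice eps \o T1inv Delta) := linear_comp ll T1inv_linear.
have lT4 := T4_linearr c.
(* Stated for all [x], so that coassociativity, known for [T1] of a pure tensor, extends linearly to
   [x = T1inv (a ⊗ b)]. *)
have key (x : A ⊗ A) : tmap (nmul^~ c) id x =
    tmap id (lslice eps \o T1inv Delta)
      (tassoc (tmap (fun p => T4 Delta (c ⊗ p)) id (T1 Delta x))).
  move: x; apply: eq_tensor => [||a' b'].
  - exact: tmap_linear.
  - apply: linear_comp (tmap_linear lid lh) _.
    apply: linear_comp (@tassoc_linear K A A A) _.
    exact: linear_comp (tmap_linear lT4 lid) T1_linear.
  rewrite coassoc_T tmap_comp //; last exact: T1_linearl.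
  have slice_pure (t : A ⊗ A) : tmap id (fun s => lslice eps (s ⊗ b')) t = rslice eps t ⊗ b'.
    move: t; apply: eq_tensor => [||r s].
    - by apply: tmap_linear => //; apply: linear_comp ll (tpure_linearl b').
    - exact: linear_comp (tpure_linearl b') lr.
    rewrite tmapE //; last exact: linear_comp ll (tpure_linearl b').
    by rewrite lsliceE // rsliceE // tpureZr tpureZl.
  rewrite (@eq_tmap K _ _ _ _ (id \o id) id _ (fun s => lslice eps (s ⊗ b'))) //.
    by rewrite slice_pure counit_T4 tmapE.
  by move=> s /=; rewrite T1K.
(* At this [x] the inner tensor is [T4 (c ⊗ a) ⊗ b], and reassociating inserts [b] next to each
   second leg. *)
rewrite key T1invK tmapE // tassocEl tmap_comp //; exact: tpure_linearl.
Qed.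

(** Mirror image of [T1inv_mulr]: the inverse of [T4] is applied to the first two legs of
    coassociativity, and the contraction of the middle leg is evaluated by [counit_T1]. *)
Lemma T4inv_mulr a b c :
  tmap id (nmul^~ b) (T4inv Delta (c ⊗ a)) =
  tmap (fun p => rslice eps (T4inv Delta (c ⊗ p))) id (T1 Delta (a ⊗ b)).
Proof.
have lh : linear (rslice eps \o T4inv Delta) := linear_comp lr T4inv_linear.
have lT1 := T1_linearl b.
have key (x : A ⊗ A) : tmap id (nmul^~ b) x =
    tmap (rslice eps \o T4inv Delta) id
      (tdissoc (tmap id (fun s => T1 Delta (s ⊗ b)) (T4 Delta x))).
  move: x; apply: eq_tensor => [||c' a'].
  - exact: tmap_linear.
  - apply: linear_comp (tmap_linear lh lid) _.
    apply: linear_comp (@tdissoc_linear K A A A) _.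
    exact: linear_comp (tmap_linear lid lT1) T4_linear.
  rewrite -coassoc_T tassocK tmap_comp //; last exact: T4_linearr.
  have slice_pure (t : A ⊗ A) : tmap (fun p => rslice eps (c' ⊗ p)) id t = c' ⊗ lslice eps t.
    move: t; apply: eq_tensor => [||p q].
    - by apply: tmap_linear => //; apply: linear_comp lr (tpure_linearr c').
    - exact: linear_comp (tpure_linearr c') ll.
    rewrite tmapE //; last exact: linear_comp lr (tpure_linearr c').
    by rewrite lsliceE // rsliceE // tpureZr tpureZl.
  rewrite (@eq_tmap K _ _ _ _ _ (fun p => rslice eps (c' ⊗ p)) (id \o id) id) //.
    by rewrite slice_pure counit_T1 tmapE.
  by move=> s /=; rewrite T4K.
rewrite key T4invK tmapE // tdissocE tmap_comp //; exact: tpure_linearr.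
Qed.

End Counit.

(* [x(c ⊗ d) = (x(c ⊗ 1))(1 ⊗ d)] and [x(c ⊗ d) = (x(1 ⊗ d))(c ⊗ 1)]. *)
Lemma ract_left_inj (x y : A ⊗ A) :
  (forall c, ract (embed c ⊠ 1) x = ract (embed c ⊠ 1) y) -> x = y.
Proof.
have mulE (t : A ⊗ A) (c d : A) : t ∙ (c ⊗ d) = tmap id (nmul^~ d) (ract (embed c ⊠ 1) t).
  move: t; apply: eq_tensor => [||a b]; first exact: nmul_linearl.
    exact: linear_comp (tmap_linear (@linear_id K A) (RA d)) (@ract_linear _ _ _).
  rewrite -[ract _ _]/(tmap (nmul^~ c) id _) tmapE //.
  by rewrite tmapE // tensor_mulE.
move=> xy; apply: (right_faithful_cancel fAA); apply: eq_tensor => [||c d].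
- exact: nmul_linearr.
- exact: nmul_linearr.
by rewrite !mulE xy.
Qed.

Lemma ract_right_inj (x y : A ⊗ A) :
  (forall d, ract (1 ⊠ embed d) x = ract (1 ⊠ embed d) y) -> x = y.
Proof.
have mulE (t : A ⊗ A) (c d : A) : t ∙ (c ⊗ d) = tmap (nmul^~ c) id (ract (1 ⊠ embed d) t).
  move: t; apply: eq_tensor => [||a b]; first exact: nmul_linearl.
    exact: linear_comp (tmap_linear (RA c) (@linear_id K A)) (@ract_linear _ _ _).
  rewrite -[ract _ _]/(tmap id (nmul^~ d) _) tmapE //.
  by rewrite tmapE // tensor_mulE.
move=> xy; apply: (right_faithful_cancel fAA); apply: eq_tensor => [||c d].
- exact: nmul_linearr.
- exact: nmul_linearr.
by rewrite !mulE xy.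
Qed.

End Hopf.

(** * The two antipode identities *)

Theorem proposition4p2 (R : realType) (A : nuAlgType R[i])
    (Delta : A -> multiplier (A ⊗ A)) (hA : left_multiplier_hopf Delta)
    (eps : {scalar A}) (heps : is_counit Delta eps)
    (S S' : A -> left_multiplier A)
    (hS : is_S Delta eps S) (hS' : is_S' Delta eps S') :
  (forall a b : A, exists x : (A ⊗ A)%type,
     unique (is_idS_Delta Delta S a b) x /\ tmul x = eps a *: b) /\
  (forall a c : A, exists y : (A ⊗ A)%type,
     unique (is_S'id_Delta Delta S' a c) y /\ tmulop y = eps a *: c).
Proof.
have leps : linear (eps : A -> (R[i])^o) by move=> k u v; apply: linearP.
split=> [a b|a c].
(* By [hS] the map on second legs in [T1inv_mulr] is q ↦ S(q)b, so that lemma is the required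
   property. *)
- have idS : is_idS_Delta Delta S a b (T1inv Delta (a ⊗ b)).
    move=> c; rewrite -[LHS]/(tmap _ id _) (T1inv_mulr hA leps heps).
    by rewrite /id_S (_ : (fun p q => p ⊗ S q b) =
        fun p q => p ⊗ eps_id eps (T1inv Delta (q ⊗ b)))
      //; apply/funext => p; apply/funext => q; rewrite hS.
  exists (T1inv Delta (a ⊗ b)); split; last by rewrite heps.
  by split=> // x idSx; apply: (ract_left_inj hA) => c; rewrite idS idSx.
- have S'id : is_S'id_Delta Delta S' a c (T4inv Delta (c ⊗ a)).
    move=> b; rewrite -[LHS]/(tmap id _ _) (T4inv_mulr hA leps heps).
    by rewrite /S'_id (_ : (fun p q => S' p c ⊗ q) =
        fun p q => id_eps eps (T4inv Delta (c ⊗ p)) ⊗ q)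
      //; apply/funext => p; apply/funext => q; rewrite hS'.
  (* For [T1] the product formula was the definition of the counit; for [T4] it is the derived
     identity [counit_T4inv]. *)
  exists (T4inv Delta (c ⊗ a)); split; last exact: (counit_T4inv hA leps heps).
  by split=> // y S'idy; apply: (ract_right_inj hA) => b; rewrite S'id S'idy.
Qed.
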